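(* If $Q_n(0)=0$ for all $n\in\mathcal N$, then under the proposed algorithm (with parameter $V>0$) each request queue is deterministically bounded: $$Q_n(t)\le Vc_{\max}+R_{\max}\qquad\text{for all }t\in\{0,1,2,\dots\}\text{ and all }n\in\mathcal N,$$ where $c_{\max}=\max_{c\in\mathcal C}c$.
   Context: Slotted time $t=0,1,2,\dots$; servers $\mathcal N=\{1,\dots,N\}$. On slot $t$, $\lambda(t)$ requests arrive ($\lambda(t)$ a nonnegative integer) and the per-request rejection cost is $c(t)$, with values in a finite set $\mathcal C$ of nonnegative numbers. The router chooses nonnegative integers $R_n(t)$ (requests routed to server $n$) and $r(t)$ (requests rejected) with $\sum_nR_n(t)+r(t)=\lambda(t)$ and $\sum_nR_n(t)\le R_{\max}$. Request queues evolve by $Q_n(t+1)=\max\{Q_n(t)+R_n(t)-\mu_n(t)H_n(t),0\}$, where $H_n(t)\in\{0,1\}$ indicates that server $n$ is active and $\mu_n(t)\ge0$ is the number of requests that can be served. The routing/rejection rule of the proposed algorithm is: each slot $t$, observing $\lambda(t),c(t)$ and all queues, if some $n$ has $Q_n(t)\le Vc(t)$, then $r(t)=\max\{\lambda(t)-R_{\max},0\}$ and $\min\{\lambda(t),R_{\max}\}$ requests are routed to a shortest queue (ties broken arbitrarily, a single queue is selected) and none to the others; otherwise $r(t)=\lambda(t)$ and $R_n(t)=0$ for all $n$. (The algorithm also specifies each server's active/sleep decisions, which determine $H_n(t)$; the bound holds for the queues resulting from the algorithm.) *)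

(* Defs.v *)
From mathcomp Require Import all_boot all_order all_algebra.
From mathcomp Require Import finmap.

Set Implicit Arguments.
Unset Strict Implicit.
Unset Printing Implicit Defensive.

Import Order.TTheory GRing.Theory Num.Theory.

Local Open Scope ring_scope.

(* The default value 0 of the iterated maximum is harmless: it is only used   *)
(* for a set of nonnegative numbers, and is attained only when C is empty or  *)
(* C = {0}.                                                                   *)
Definition cmax (R : realFieldType) (C : {fset R}) : R :=
  \big[Num.max/0]_(c <- C) c.

(* One-slot constraints on the routed numbers (rt n) and rejected number rj,  *)
(* when lam requests arrive.                                                  *)
Definition feasible_decision (N : nat) (Rmax lam : nat)
    (rt : 'I_N -> nat) (rj : nat) : Prop :=
  (\sum_(n < N) rt n + rj = lam)%N /\ (\sum_(n < N) rt n <= Rmax)%N.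

Definition shortest_queue (R : realFieldType) (N : nat) (q : 'I_N -> R)
    (k : 'I_N) : Prop :=
  forall n, q k <= q n.

(* The rule is a relation, not a function: the existentially quantified k     *)
(* leaves tie-breaking arbitrary.  The subtraction on nat is truncated, so    *)
(* lam - Rmax is max{lam - Rmax, 0}.                                          *)
Definition routing_rule (R : realFieldType) (N : nat) (V : R) (Rmax : nat)
    (lam : nat) (c : R) (q : 'I_N -> R) (rt : 'I_N -> nat) (rj : nat) : Prop :=
  if [exists n, q n <= V * c] then
    rj = (lam - Rmax)%N /\
    exists k, shortest_queue q k /\
      forall n, rt n = if n == k then minn lam Rmax else 0%N
  else
    rj = lam /\ forall n, rt n = 0%N.

Definition queue_update (R : realFieldType) (q mu : R) (a : nat) (H : bool)
  : R :=
  Num.max (q + a%:R - mu * H%:R) 0.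

(* Main.v *)
(* A queue only receives requests when its backlog is at most V c(t), hence at
   most V cmax, and then it receives at most Rmax of them; otherwise it does
   not grow. *)
Require Import Defs.
From mathcomp Require Import all_boot all_order all_algebra.
From mathcomp Require Import finmap.

Set Implicit Arguments.
Unset Strict Implicit.
Unset Printing Implicit Defensive.

Import Order.TTheory GRing.Theory Num.Theory.

Local Open Scope ring_scope.

(** Induction on time, for all queues at once. By [routing_rule_cases], a slot either sends queue
    [n] nothing, so the previous bound persists, or sends it at most [Rmax] requests while its
    backlog is at most [V * c t <= V * cmax C]. By [queue_update_le], service cannot break a bound
    that holds just after the arrivals. *)

Lemma cmax_ge0 (R : realFieldType) (C : {fset R}) : 0 <= cmax C.
Proof. exact: bigmax_ge_id. Qed.

Lemma le_cmax (R : realFieldType) (C : {fset R}) (x : R) :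
  x \in C -> x <= cmax C.
Proof. by move=> xC; apply: (@bigmax_sup_seq _ _ _ _ _ x). Qed.

Lemma queue_update_le (R : realFieldType) (q mu B : R) (a : nat) (H : bool) :
  0 <= mu -> 0 <= B -> q + a%:R <= B -> queue_update q mu a H <= B.
Proof.
move=> mu_ge0 B_ge0 qaB; rewrite /queue_update ge_max B_ge0 andbT.
by apply: le_trans qaB; rewrite gerBl mulr_ge0 ?ler0n.
Qed.

(** The rule only tests whether some queue [m] is below the threshold; the queue that receives
    requests is a shortest one, so it lies below [q m] and inherits the threshold. *)
Lemma routing_rule_cases (R : realFieldType) (N : nat) (V c : R)
    (Rmax lam rj : nat) (q : 'I_N -> R) (rt : 'I_N -> nat) (n : 'I_N) :
  routing_rule V Rmax lam c q rt rj ->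
  rt n = 0%N \/ (q n <= V * c /\ (rt n <= Rmax)%N).
Proof.
rewrite /routing_rule; case: existsP => [[m qm] [_ [k [kmin rtE]]]|_ [_ rt0]];
  last by left.
rewrite rtE; case: eqP => [->|_]; last by left.
by right; rewrite geq_minr (le_trans (kmin m) qm).
Qed.

Theorem lemma3p3p1 (R : realFieldType) (N : nat) (V : R) (Rmax : nat)
    (C : {fset R})
    (lambda : nat -> nat) (c : nat -> R)
    (rt : 'I_N -> nat -> nat) (rj : nat -> nat)
    (mu : 'I_N -> nat -> R) (H : 'I_N -> nat -> bool)
    (Q : 'I_N -> nat -> R)
    (V_gt0 : 0 < V)
    (C_ge0 : forall x, x \in C -> 0 <= x)
    (c_in : forall t, c t \in C)
    (mu_ge0 : forall n t, 0 <= mu n t)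
    (feasible : forall t,
       feasible_decision Rmax (lambda t) (fun n => rt n t) (rj t))
    (rule : forall t,
       routing_rule V Rmax (lambda t) (c t) (fun n => Q n t)
         (fun n => rt n t) (rj t))
    (Q_next : forall n t,
       Q n t.+1 = queue_update (Q n t) (mu n t) (rt n t) (H n t))
    (Q_init : forall n, Q n 0%N = 0) :
  forall (t : nat) (n : 'I_N), Q n t <= V * cmax C + Rmax%:R.
Proof.

have VC_ge0 : 0 <= V * cmax C by rewrite mulr_ge0 ?cmax_ge0 // ltW.
have B_ge0 : 0 <= V * cmax C + Rmax%:R by rewrite addr_ge0.
elim=> [|t IHt] n; first by rewrite Q_init.
rewrite Q_next; apply: queue_update_le => //.
(* The induction hypothesis serves only the case without arrivals; otherwise the threshold alone
   bounds the backlog. *)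
have [->|[Qn rn]] := routing_rule_cases n (rule t); first by rewrite addr0.
rewrite lerD ?ler_nat //; apply: le_trans Qn _.
by rewrite ler_pM2l // le_cmax.
Qed.
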